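(* Let $F$ be a commutative field of characteristic $\neq 2$ and let $\mathcal{E}$ be a finite-dimensional evolution algebra over $F$ that is power-associative and is not a nilalgebra. Then there exist an integer $s\geq 1$ and nonzero pairwise orthogonal idempotents $u_1,u_2,\ldots,u_s$ of $\mathcal{E}$ such that $$\mathcal{E}=Fu_1\oplus Fu_2\oplus\cdots\oplus Fu_s\oplus N,$$ a direct sum of algebras, where $N$ is either zero or a nil power-associative evolution algebra. Furthermore $\mathcal{E}_{ss}=Fu_1\oplus\cdots\oplus Fu_s$ is the semisimple component of $\mathcal{E}$ and $N=\mathrm{Rad}(\mathcal{E})$ is the nil radical of $\mathcal{E}$.
   Context: An $n$-dimensional (not necessarily associative) algebra $\mathcal{E}$ over $F$ is an evolution algebra if it has a basis $\{e_1,\ldots,e_n\}$ (a natural basis) with $e_ie_j=0$ for all $i\neq j$ (and $e_i^2$ arbitrary); such an algebra is commutative. An algebra is power-associative if the subalgebra generated by each single element is associative. Principal powers are $a^1=a$, $a^{k+1}=a^ka$; an algebra is nil (a nilalgebra) if for every element $a$ there is $n(a)\ge 1$ with $a^{n(a)}=0$. Idempotents $u,v$ are orthogonal if $uv=0$. ''Direct sum of algebras'' means a direct sum of vector subspaces which are subalgebras whose pairwise products are zero. The nil radical $\mathrm{Rad}(\mathcal{E})$ of a finite-dimensional commutative power-associative algebra is its unique maximal nil ideal; the algebra is semisimple if its nil radical is zero. ''Semisimple component'' means the semisimple subalgebra complementing the nil radical in this decomposition. *)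

(* Defs.v *)
From HB Require Import structures.
From mathcomp Require Import all_boot all_order all_algebra.
From mathcomp Require Export sesquilinear.

Set Implicit Arguments.
Unset Strict Implicit.
Unset Printing Implicit Defensive.

Import GRing.Theory.
Local Open Scope ring_scope.

(* A finite-dimensional, not necessarily associative, algebra over F is a
   vectType E together with a bilinear multiplication mul.  Subalgebras are
   subspaces U : {vspace E}; the predicates below are relativized to U, so that
   they apply to subalgebras as algebras in their own right, and to the whole
   algebra by taking U to be fullv. *)
Section EvolutionAlgebra.

Context {F : fieldType} {E : vectType F}.
Variable mul : {bilinear E -> E -> E}.

Implicit Types (U N M : {vspace E}) (a u : E).

Definition subalgebra U : Prop :=
  forall x y, x \in U -> y \in U -> mul x y \in U.

Definition evolution_algebra U : Prop :=
  subalgebra U /\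
  exists2 e : (\dim U).-tuple E, basis_of U e &
    forall i j : 'I_(\dim U), i != j -> mul (tnth e i) (tnth e j) = 0.

Definition in_generated_subalgebra a x : Prop :=
  forall V : {vspace E}, subalgebra V -> a \in V -> x \in V.

(* For a in a subalgebra U, the subalgebra generated by a is the same whether
   computed in U or in E. *)
Definition power_associative U : Prop :=
  forall a, a \in U ->
  forall x y z,
    in_generated_subalgebra a x ->
    in_generated_subalgebra a y ->
    in_generated_subalgebra a z ->
    mul (mul x y) z = mul x (mul y z).

(* a^1 = a and a^(n+1) = a^n a for n >= 1; the value at n = 0 is junk. *)
Definition principal_power a (n : nat) : E := iter n.-1 (mul^~ a) a.

Definition nilalgebra U : Prop :=
  forall a, a \in U -> exists2 n : nat, (1 <= n)%N & principal_power a n = 0.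

Definition idempotent_elt u : Prop := mul u u = u.

Definition ideal U M : Prop :=
  (M <= U)%VS /\
  forall x y, x \in U -> y \in M -> mul x y \in M /\ mul y x \in M.

Definition nil_ideal U M : Prop := ideal U M /\ nilalgebra M.

Definition maximal_nil_ideal U M : Prop :=
  nil_ideal U M /\ forall M', nil_ideal U M' -> (M <= M')%VS -> M' = M.

Definition nil_radical U N : Prop :=
  maximal_nil_ideal U N /\ forall M, maximal_nil_ideal U M -> M = N.

Definition semisimple U : Prop := subalgebra U /\ nil_radical U 0%VS.

Definition direct_sum_of_algebras (I : finType) (V : I -> {vspace E}) U : Prop :=
  [/\ (\sum_i V i)%VS = U,
      directv (\sum_i V i)%VS,
      forall i, subalgebra (V i) &
      forall i j, i != j ->
        forall x y, x \in V i -> y \in V j -> mul x y = 0].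

Definition semisimple_component U S : Prop :=
  semisimple S /\
  exists2 R : {vspace E}, nil_radical U R &
    (S + R)%VS = U /\ directv (S + R)%VS.

End EvolutionAlgebra.

(* Main.v *)
(* Write [b_i = e_i^2] and let [c_ij] be the coordinate of [b_i] on [e_j].
   Comparing [x^2 x^2 = x^4] at [e_i + e_j] and [e_i - e_j] yields
     2 b_i b_j = c_ij c_jj b_j + c_ji c_ii b_i,
     c_ji (c_ij + c_jj) b_i + c_ij (c_ii + c_ji) b_j = 0.
   They force [e_k b_i = 0] and [c_ki = 0] whenever [c_ii <> 0] and [k <> i], so
   that [u_i = b_i / c_ii^2] is an idempotent and [x |-> c_ii x_i] is an algebra
   morphism [chi_i] to [F] with [u_i x = chi_i x u_i].  The common kernel [N] of
   the [chi_i] is spanned by the [e_j] with [c_jj = 0].  The first relation gives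
   [b_i b_j = 0] for such indices, so every [x] in [N] satisfies
   [x^4 = x^2 x^2 = 0].  Conversely a nil element is killed by every [chi_i], so
   [N] contains every nil ideal.

   Over fields with more than three elements, [x^2 x^2 = x^4] at [e_i + t e_j]
   would separate the odd degrees in [t] and give stronger relations; using only
   [t = 1] and [t = -1] covers the field with three elements as well. *)

Require Import Defs.
From HB Require Import structures.
From mathcomp Require Import all_boot all_order all_algebra.
From mathcomp Require Import ring.

Set Implicit Arguments.
Unset Strict Implicit.
Unset Printing Implicit Defensive.

Import GRing.Theory.
Local Open Scope ring_scope.

(** * Scalar coordinates of vectors *)

Section Coordinates.

Context (F : fieldType) (E : vectType F).

(* Coordinates turn identities between vectors into identities in [F], which
   [ring] can decide. *)
Definition crd (k : 'I_(\dim {:E})) (x : E) : F := coord (vbasis fullv) k x.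

Lemma crdE k : (forall x y, crd k (x + y) = crd k x + crd k y)
  * (forall a x, crd k (a *: x) = a * crd k x)
  * (forall x, crd k (- x) = - crd k x)
  * (forall x n, crd k (x *+ n) = crd k x *+ n) * (crd k 0 = 0).
Proof.
rewrite /crd; do !split => *; last exact: linear0.
- exact: linearD.
- exact: linearZ.
- exact: linearN.
- exact: linearMn.
Qed.

Lemma crd_inj x y : (forall k, crd k x = crd k y) -> x = y.
Proof.
move=> xy; rewrite (coord_vbasis (memvf x)) (coord_vbasis (memvf y)).
by apply: eq_bigr => k _; rewrite -/(crd k x) xy.
Qed.

End Coordinates.

(** * Consequences of [x^2 x^2 = x^4] for a pair with zero product *)

Section FourthPower.

Context (F : fieldType) (E : vectType F) (mul : {bilinear E -> E -> E}).
Local Notation "x ** y" := (mul x y) (at level 40, left associativity).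

Hypothesis two_neq0 : 2%:R != 0 :> F.
Hypothesis mulC : forall x y, x ** y = y ** x.
Hypothesis fourth_power : forall x, x ** x ** (x ** x) = x ** x ** x ** x.

Lemma double_eq0 (v : E) : v *+ 2 = 0 -> v = 0.
Proof.
move=> /eqP; rewrite -scaler_nat scaler_eq0 (negPf two_neq0) => /eqP; exact.
Qed.

(** Each further factor [f] multiplies the square by [a], so the principal fourth power carries [a]
    twice. *)
Lemma sqr_sqr_eigen f a : f ** (f ** f) = a *: (f ** f) ->
  f ** f ** (f ** f) = (a * a) *: (f ** f).
Proof.
move=> fb; rewrite fourth_power (mulC (f ** f)) fb linearZl_LR /=.
by rewrite (mulC (f ** f)) fb scalerA.
Qed.

(** The fourth powers at [f + t *: g] are compared for [t = 1] and [t = -1]: the sum of the two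
    identities isolates [b ** d], the difference keeps the terms odd in [t]. Both come out doubled,
    and 2 is cancelled. *)
Lemma pair_relations f g b d al be ga de :
    f ** g = 0 -> f ** f = b -> g ** g = d ->
    f ** b = al *: b -> f ** d = ga *: b ->
    g ** d = be *: d -> g ** b = de *: d ->
  (b ** d) *+ 2 = (al * ga) *: b + (be * de) *: d /\
  ((be + de) * ga) *: b + ((al + ga) * de) *: d = 0.
Proof.
move=> fg ff gg fb fd gd gb.
have bb : b ** b = (al * al) *: b.
  by have := @sqr_sqr_eigen f al; rewrite ff; apply.
have dd : d ** d = (be * be) *: d.
  by have := @sqr_sqr_eigen g be; rewrite gg; apply.
have key t : t = 1 \/ t = -1 ->
    (al * al) *: b + (be * be) *: d + (b ** d) *+ 2 =
    ((al + ga) * al + t * (be + de) * ga) *: b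
      + (t * (al + ga) * de + (be + de) * be) *: d.
  move=> tE; have tt : t * t = 1 by case: tE => ->; ring.
  have := fourth_power (f + t *: g).
  have -> : (f + t *: g) ** (f + t *: g) = b + d.
    rewrite linearDl !linearDr /= !linearZl_LR !linearZr_LR /=.
    by rewrite (mulC g f) fg ff gg scalerA tt scaler0 scale1r addr0 add0r.
  have -> : (b + d) ** (f + t *: g) = (al + ga) *: b + (t * (be + de)) *: d.
    rewrite linearDl !linearDr /= !linearZr_LR /=.
    rewrite (mulC b f) (mulC d f) (mulC b g) (mulC d g) fb fd gb gd.
    by apply: crd_inj => k; rewrite !crdE; ring.
  rewrite !linearDl !linearDr /= bb dd (mulC d b).
  rewrite !linearZl_LR !linearZr_LR /=.
  rewrite (mulC b f) (mulC d f) (mulC b g) (mulC d g) fb fd gb gd => e4.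
  apply: crd_inj => k; move: e4 => /(congr1 (crd k)).
  rewrite !crdE => e4; apply: etrans (etrans _ e4) _; first ring.
  by case: tE => ->; ring.
have {key} [kp km] := (key 1 (or_introl erefl), key (-1) (or_intror erefl)).
split; [apply/eqP; rewrite -subr_eq0; apply/eqP|]; apply: double_eq0;
  apply: crd_inj => k;
  move: kp km => /(congr1 (crd k)) kp;
  move=> /(congr1 (crd k)) km;
  move: kp km; rewrite !crdE => /eqP; rewrite -subr_eq0 => /eqP kp;
  move=> /eqP; rewrite -subr_eq0 => /eqP km.
- by apply: etrans (_ : _ = 0 + 0) (addr0 0); rewrite -{1}kp -km; ring.
- by apply: etrans (_ : _ = 0 - 0) (subr0 0); rewrite -{1}km -kp; ring.
Qed.

(** Suppose [ga *: b] is nonzero. The second relation of [pair_relations] leaves two cases. Either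
    [ga = de = -1], which a fourth power at [b - d] excludes, or [d] is a multiple of [b]; being
    nonzero idempotents they are equal, so [ga = de = 1] and the relation reads [4 b = 0]. *)
Lemma orthogonal_idempotents f g b d ga de :
    f ** g = 0 -> f ** f = b -> g ** g = d ->
    f ** b = b -> g ** d = d -> f ** d = ga *: b -> g ** b = de *: d ->
  f ** d = 0.
Proof.
move=> fg ff gg fb gd fd gb.
have bb : b ** b = b.
  by have := @sqr_sqr_eigen f 1; rewrite ff mulr1 !scale1r; apply.
have dd : d ** d = d.
  by have := @sqr_sqr_eigen g 1; rewrite gg mulr1 !scale1r; apply.
have := @pair_relations f g b d 1 1 ga de fg ff gg.
rewrite !scale1r !mul1r => /(_ fb fd gd gb) [bd rel].
have [b0|bN0] := eqVneq b 0; first by rewrite fd b0 scaler0.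
have [ga0|gaN0] := eqVneq ga 0; first by rewrite fd ga0 scale0r.
have [gaE|gaN1] := eqVneq (1 + ga) 0.
  have gaE' : ga = -1 by apply/eqP; rewrite -addr_eq0 addrC gaE.
  move: rel; rewrite gaE mul0r scale0r addr0 => /eqP.
  rewrite scaler_eq0 (negPf bN0) orbF mulf_eq0 (negPf gaN0) orbF => /eqP deE.
  have deE' : de = -1 by apply/eqP; rewrite -addr_eq0 addrC deE.
  (* Here [b ** d *+ 2 = - (b + d)]; the fourth power of [b - d] is then
     [(b + d) *+ 4] while its square squares to [0]. *)
  have sq : (b - d) ** (b - d) = (b + d) *+ 2.
    transitivity (b + d - b ** d *+ 2).
      rewrite linearBl !linearBr /= bb dd (mulC d b).
      by apply: crd_inj => k; rewrite !crdE; ring.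
    by rewrite bd gaE' deE'; apply: crd_inj => k; rewrite !crdE; ring.
  have ss : (b + d) ** (b + d) = 0.
    transitivity (b + d + b ** d *+ 2).
      rewrite linearDl !linearDr /= bb dd (mulC d b).
      by apply: crd_inj => k; rewrite !crdE; ring.
    by rewrite bd gaE' deE'; apply: crd_inj => k; rewrite !crdE; ring.
  have sd : (b + d) ** (b - d) = b - d.
    rewrite linearDl !linearBr /= bb dd (mulC d b).
    by apply: crd_inj => k; rewrite !crdE; ring.
  have := fourth_power (b - d).
  have -> : (b - d) ** (b - d) ** (b - d) = (b - d) *+ 2.
    by rewrite sq linearMnl /= sd.
  rewrite [in LHS]sq linearMnl linearMnr /= ss !mul0rn linearMnl /= sq.
  move=> /esym/double_eq0/double_eq0 bd0.
  have dE : d = - b by apply/eqP; rewrite -addr_eq0 addrC bd0.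
  (* Here [b = b ** b = d ** d = d = - b]. *)
  have := @double_eq0 b; rewrite mulr2n -{2}bb -[b ** b]opprK.
  rewrite -[- (b ** b)]linearNr -linearNl /= -dE dd dE subrr => b0.
  by rewrite b0 ?eqxx in bN0.
have [de0|deN0] := eqVneq de 0.
  move: rel => /eqP; rewrite de0 mulr0 scale0r addr0 addr0 scaler_eq0 mul1r.
  by rewrite (negPf gaN0) (negPf bN0).
have [ka dE] : exists ka, d = ka *: b.
  (* The relation [rel] solved for [d]. *)
  exists (- ((1 + ga) * de)^-1 * ((1 + de) * ga)).
  have nz : (1 + ga) * de != 0 by rewrite mulf_neq0.
  apply: (scalerI nz); rewrite scalerA mulrA mulrN divff // mulN1r scaleNr.
  by apply/eqP; rewrite -addr_eq0 addrC rel.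
have [d0|dN0] := eqVneq d 0; first by rewrite d0 linear0r.
have db : d = b.
  have ka0 : ka != 0 by apply: contraNneq dN0 => ka0; rewrite dE ka0 scale0r.
  have := dd; rewrite dE linearZl_LR linearZr_LR /= bb scalerA => /eqP.
  rewrite -subr_eq0 -scalerBl scaler_eq0 (negPf bN0) orbF -{3}[ka]mulr1.
  rewrite -mulrBr mulf_eq0 (negPf ka0) subr_eq0 => /eqP ->.
  by rewrite scale1r.
have one x : b = x *: b -> x = 1.
  move=> /eqP; rewrite -{1}[b]scale1r -subr_eq0 -scalerBl scaler_eq0.
  by rewrite (negPf bN0) orbF subr_eq0 => /eqP.
have ga1 : ga = 1 by apply: one; rewrite -fd db fb.
have de1 : de = 1 by apply: one; rewrite -{2}db -gb -db gd.
move: rel; rewrite db ga1 de1 !mulr1 => rel.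
have : b *+ 2 *+ 2 = 0.
  by rewrite -[RHS]rel; apply: crd_inj => k; rewrite !crdE; ring.
by move=> /double_eq0/double_eq0 b0; rewrite b0 eqxx in bN0.
Qed.

(** If [b] and [de] are nonzero, the second relation of [pair_relations] with [be = 0] makes [d] a
    multiple of the idempotent [b]. As [d] squares to zero, it vanishes, and so does
    [g ** b = de *: d]. *)
Lemma idempotent_absorbs_nil f g b d ga de :
    f ** g = 0 -> f ** f = b -> g ** g = d ->
    f ** b = b -> g ** d = 0 -> f ** d = ga *: b -> g ** b = de *: d ->
  g ** b = 0 /\ (b ** d) *+ 2 = ga *: b.
Proof.
move=> fg ff gg fb gd fd gb.
have bb : b ** b = b.
  by have := @sqr_sqr_eigen f 1; rewrite ff mulr1 !scale1r; apply.
have dd : d ** d = 0.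
  have := @sqr_sqr_eigen g 0; rewrite gg mulr0 !scale0r; exact.
have := @pair_relations f g b d 1 0 ga de fg ff gg.
rewrite scale1r mul1r mul0r !scale0r addr0 add0r => /(_ fb fd gd gb) [bd rel].
split=> //.
have [->|bN0] := eqVneq b 0; first by rewrite linear0r.
have [de0|deN0] := eqVneq de 0; first by rewrite gb de0 scale0r.
have [gaE|gaN1] := eqVneq (1 + ga) 0.
  have gaE' : ga = -1 by apply/eqP; rewrite -addr_eq0 addrC gaE.
  move: rel => /eqP; rewrite gaE mul0r scale0r addr0 gaE' mulrN1 scaler_eq0.
  by rewrite oppr_eq0 (negPf deN0) (negPf bN0).
have [ka dE] : exists ka, d = ka *: b.
  exists (- ((1 + ga) * de)^-1 * (de * ga)).
  have nz : (1 + ga) * de != 0 by rewrite mulf_neq0.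
  apply: (scalerI nz); rewrite scalerA mulrA mulrN divff // mulN1r scaleNr.
  by apply/eqP; rewrite -addr_eq0 addrC rel.
move: dd => /eqP; rewrite dE linearZl_LR linearZr_LR /= bb !scaler_eq0.
by rewrite (negPf bN0) orbF orbb gb dE => /eqP ->; rewrite scale0r scaler0.
Qed.

End FourthPower.

(** * The decomposition given by characters and their dual idempotents *)

Section Characters.

Context (F : fieldType) (E : vectType F) (mul : {bilinear E -> E -> E}).
Context (s : nat) (u : 'I_s -> E) (chi : 'I_s -> {scalar E}) (N : {vspace E}).
Local Notation "x ** y" := (mul x y) (at level 40, left associativity).

Hypothesis mulC : forall x y, x ** y = y ** x.
Hypothesis chiM : forall k x y, chi k (x ** y) = chi k x * chi k y.
Hypothesis chi_u : forall k l, chi k (u l) = (k == l)%:R.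
Hypothesis u_mul : forall k x, u k ** x = chi k x *: u k.
Hypothesis inN : forall x, x \in N <-> forall k, chi k x = 0.
Hypothesis nilN : nilalgebra mul N.

Local Notation lines := (\sum_(k < s) <[u k]>)%VS.

Lemma line_u k x : x \in <[u k]>%VS -> x = chi k x *: u k.
Proof. by case/vlineP => a ->; rewrite linearZ /= chi_u eqxx mulr1. Qed.

Lemma chi_line_neq k l x : l != k -> x \in <[u k]>%VS -> chi l x = 0.
Proof.
by move=> lk /line_u ->; rewrite linearZ /= chi_u (negPf lk) mulr0.
Qed.

Lemma subalgebra_line k : subalgebra mul <[u k]>%VS.
Proof.
by move=> x y /line_u -> _; rewrite linearZl_LR u_mul /= !memvZ ?memv_line.
Qed.

Lemma mul_lines k l x y : k != l ->
  x \in <[u k]>%VS -> y \in <[u l]>%VS -> x ** y = 0.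
Proof.
move=> kl /line_u -> yl; rewrite linearZl_LR u_mul /=.
by rewrite (chi_line_neq kl yl) scale0r scaler0.
Qed.

Lemma lines_expand x : x \in lines -> x = \sum_k chi k x *: u k.
Proof.
case/memv_sumP => xs xsk xE.
rewrite {1}xE; apply: eq_bigr => k _; rewrite {1}(line_u (xsk k isT)).
congr (_ *: _); rewrite xE linear_sum (bigD1 k) //= big1 ?addr0 // => l lk.
by rewrite (chi_line_neq _ (xsk l isT)) // eq_sym.
Qed.

(** Applying [chi k] to a vanishing sum isolates its component on [u k]. *)
Lemma directv_lines : directv lines.
Proof.
apply/directv_sum_independent => xs xsk xs0 k _.
rewrite (line_u (xsk k isT)); suff -> : chi k (xs k) = 0 by rewrite scale0r.
have := congr1 (chi k) xs0; rewrite linear0 linear_sum (bigD1 k) //=.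
rewrite big1 ?addr0 // => l lk.
by rewrite (chi_line_neq _ (xsk l isT)) // eq_sym.
Qed.

Lemma direct_sum_lines : direct_sum_of_algebras mul (fun k => <[u k]>%VS) lines.
Proof.
split=> //; [exact: directv_lines | exact: subalgebra_line|].
by move=> k l kl x y; apply: mul_lines.
Qed.

Lemma chi_eq0_lines x : x \in lines -> (forall k, chi k x = 0) -> x = 0.
Proof.
by move=> /lines_expand xE chi0; rewrite xE big1 // => k _; rewrite chi0 scale0r.
Qed.

Lemma proj_lines x : \sum_k chi k x *: u k \in lines.
Proof.
by apply: memv_sumr => k _; rewrite memvZ ?memv_line.
Qed.

Lemma proj_N x : x - \sum_k chi k x *: u k \in N.
Proof.
apply/inN => k; rewrite linearB linear_sum (bigD1 k) //= big1 ?addr0.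
  by rewrite linearZ /= chi_u eqxx mulr1 subrr.
by move=> l lk; rewrite linearZ /= chi_u eq_sym (negPf lk) mulr0.
Qed.

Lemma lines_addN : (lines + N)%VS = fullv.
Proof.
apply/eqP; rewrite eqEsubv subvf; apply/subvP => x _.
by rewrite -[x](subrK (\sum_k chi k x *: u k)) addrC memv_add ?proj_lines ?proj_N.
Qed.

Lemma lines_capN : (lines :&: N)%VS = 0%VS.
Proof.
apply/eqP; rewrite -subv0; apply/subvP => x.
by rewrite memv_cap => /andP[xS /inN xN]; rewrite memv0 (chi_eq0_lines xS xN).
Qed.

Lemma subalgebra_N : subalgebra mul N.
Proof. by move=> x y /inN xN _; apply/inN => k; rewrite chiM xN mul0r. Qed.

Lemma direct_sum_lines_N : direct_sum_of_algebras mul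
  (fun k : option 'I_s => if k is Some i then <[u i]>%VS else N) fullv.
Proof.
(* The index [None] stands for [N]. The law is arbitrary because the splitting serves both sums of
   subspaces and sums of vectors. *)
have bigo (T : Type) (idx : T) (op : Monoid.com_law idx) (G : option 'I_s -> T) :
    \big[op/idx]_k G k = op (G None) (\big[op/idx]_(k < s) G (Some k)).
  rewrite (bigD1 None) //=; congr (op _ _).
  rewrite (reindex_omap Some id) /=; last by case.
  by apply: eq_bigl => k; rewrite eqxx.
split.
- by rewrite bigo -lines_addN; exact: addvC.
- apply/directv_sum_independent => xs xsk; rewrite bigo /= => xs0.
  have chi0 k : chi k (xs (Some k)) = 0.
    have := congr1 (chi k) xs0; rewrite linear0 linearD linear_sum (bigD1 k) //=.
    have /inN -> := xsk None isT.
    rewrite big1 ?addr0 ?add0r // => l lk.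
    by rewrite (chi_line_neq _ (xsk (Some l) isT)) // eq_sym.
  have xSome k : xs (Some k) = 0.
    by rewrite (line_u (xsk (Some k) isT)) chi0 scale0r.
  move=> [k|] _ //; move: xs0; rewrite big1 ?addr0 // => k _; exact: xSome.
- by case=> [k|]; [exact: subalgebra_line | exact: subalgebra_N].
- have uN k x y : x \in <[u k]>%VS -> y \in N -> x ** y = 0.
    move=> /line_u -> /inN yN.
    by rewrite linearZl_LR u_mul /= yN scale0r scaler0.
  move=> [k|] [l|] // kl x y xk yl; first by apply: mul_lines xk yl.
    exact: uN xk yl.
  by rewrite mulC; exact: uN yl xk.
Qed.

(** The exponent is [n.-1.+1] because [principal_power] takes the value [x] at 0 as well as at 1. *)
Lemma chi_principal_power k x n : chi k (principal_power mul x n) =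
  chi k x ^+ n.-1.+1.
Proof.
by rewrite /principal_power; elim: n.-1 => //= m IH; rewrite chiM IH -exprSr.
Qed.

(** A character sends a nil element to a nilpotent scalar, hence to 0. This bounds the nil ideals of
    the whole algebra and those of [lines] alike. *)
Lemma nilalgebra_subN M : nilalgebra mul M -> (M <= N)%VS.
Proof.
move=> nilM; apply/subvP => x /nilM[n n0 xn0]; apply/inN => k.
have := chi_principal_power k x n; rewrite xn0 linear0 => /esym/eqP.
by rewrite expf_eq0 => /andP[_ /eqP].
Qed.

Lemma ideal_N : ideal mul fullv N.
Proof.
split=> [|x y _ /inN yN]; first exact: subvf.
by split; apply/inN => k; rewrite chiM yN ?mulr0 ?mul0r.
Qed.

(** A maximal nil ideal lies in the largest one, so it equals it. *)
Lemma nil_radical_max U M : nil_ideal mul U M ->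
  (forall M', nil_ideal mul U M' -> (M' <= M)%VS) -> nil_radical mul U M.
Proof.
move=> nilM maxM; split; first split=> // M' nilM' MM'.
  by apply/eqP; rewrite eqEsubv MM' maxM //.
by move=> M' [nilM' max']; rewrite (max' M nilM (maxM _ nilM')).
Qed.

Lemma nil_radical_N : nil_radical mul fullv N.
Proof.
apply: nil_radical_max; first by split; [exact: ideal_N | exact: nilN].
by move=> M [_ /nilalgebra_subN].
Qed.

Lemma semisimple_lines : semisimple mul lines.
Proof.
split.
  move=> x y /lines_expand -> _; rewrite linear_sumlz; apply: memv_sumr => k _.
  by rewrite linearZl_LR u_mul /= !memvZ ?memv_line.
apply: nil_radical_max.
  split; last by move=> x; rewrite memv0 => /eqP ->; exists 1%N.
  split=> [|x y _]; first exact: sub0v.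
  by rewrite memv0 => /eqP ->; rewrite linear0l linear0r mem0v.
(* A nil ideal of [lines] lies in both [lines] and [N], which meet in 0. *)
move=> M [[MS _] nilM]; rewrite -lines_capN subv_cap MS.
exact: nilalgebra_subN nilM.
Qed.

Lemma semisimple_component_lines : semisimple_component mul fullv lines.
Proof.
split; first exact: semisimple_lines.
exists N; first exact: nil_radical_N.
by split; [exact: lines_addN | apply/directv_addP; exact: lines_capN].
Qed.

End Characters.

(** * Spans of subfamilies of a natural basis *)

Section Subfamily.

Context (F : fieldType) (E : vectType F) (n : nat) (e : n.-tuple E).
Implicit Types A : {pred 'I_n}.

Definition subfamily A : seq E := [seq e`_(nat_of_ord i) | i <- enum A].

(** Up to permutation, [e] is the subfamily of the complement followed by that of [A]. *)
Lemma free_subfamily A : free e -> free (subfamily A).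
Proof.
have -> : tval e = [seq e`_(nat_of_ord i) | i <- enum 'I_n].
  rewrite -[LHS](mkseq_nth 0) size_tuple /mkseq -val_enum_ord -map_comp.
  exact: eq_map.
rewrite (perm_free (_ : perm_eq _ (subfamily [predC A] ++ subfamily A))).
  exact: catr_free.
by rewrite -map_cat perm_map // perm_sym perm_catC !enumT perm_filterC.
Qed.

Lemma mem_span_subfamily A x : basis_of fullv e ->
  x \in <<subfamily A>>%VS <-> forall i, i \notin A -> coord e i x = 0.
Proof.
move=> e_basis; rewrite span_def big_map big_enum.
split=> [/memv_sumP[xs xsk -> i iA]|x0].
  rewrite linear_sum big1 //= => j jA.
  have /vlineP[a ->] := xsk j jA.
  rewrite linearZ /= coord_free ?(basis_free e_basis) //.
  by have [ji|_] := eqVneq j i; [rewrite -ji jA in iA | exact: mulr0].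
rewrite (coord_basis e_basis (memvf x)) (bigID [in A]) /=.
rewrite [X in _ + X]big1 ?addr0 => [|i iA]; last by rewrite x0 ?scale0r.
by apply: memv_sumr => i _; rewrite memvZ ?memv_line.
Qed.

Lemma evolution_subfamily (mul : {bilinear E -> E -> E}) A : free e ->
  (forall i j : 'I_n, i != j -> mul e`_i e`_j = 0) ->
  subalgebra mul <<subfamily A>> -> evolution_algebra mul <<subfamily A>>.
Proof.
move=> /(free_subfamily A) freeA e_orth subA; split=> //.
have szA : size (subfamily A) == \dim <<subfamily A>> by rewrite eq_sym.
exists (Tuple szA); first by rewrite /basis_of /= eqxx.
move=> i j ij; rewrite !(tnth_nth 0) /=.
have szi (k : 'I_(\dim <<subfamily A>>)) : (k < size (enum A))%N.
  by rewrite -(size_map (fun i : 'I_n => e`_i)) (eqP szA).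
(* A default index for [nth_map]; the bound on [i] shows that [enum A] is not empty. *)
have i0 : 'I_n by case: (enum A) (szi i).
rewrite !(nth_map i0) //; apply: e_orth.
by rewrite nth_uniq ?enum_uniq.
Qed.

End Subfamily.

(** * Structure constants of a natural basis *)

Section NaturalBasis.

Context (F : fieldType) (E : vectType F) (mul : {bilinear E -> E -> E}).
Context (n : nat) (e : n.-tuple E).
Local Notation "x ** y" := (mul x y) (at level 40, left associativity).

Hypothesis two_neq0 : 2%:R != 0 :> F.
Hypothesis e_basis : basis_of fullv e.
Hypothesis e_orth : forall i j : 'I_n, i != j -> e`_i ** e`_j = 0.
Hypothesis fourth_power : forall x, x ** x ** (x ** x) = x ** x ** x ** x.

Implicit Types i j k : 'I_n.

Local Notation sq i := (e`_i ** e`_i).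

Definition diag_coef i : F := coord e i (sq i).

Definition diag_char i (x : E) : F := diag_coef i * coord e i x.

Lemma diag_char_scalar i : scalar (diag_char i).
Proof. by move=> a x y; rewrite /diag_char linearP mulrDr mulrCA. Qed.

HB.instance Definition _ i :=
  GRing.isLinear.Build F E F *%R (diag_char i) (diag_char_scalar i).

Lemma basis_mul i x : e`_i ** x = coord e i x *: sq i.
Proof.
rewrite {1}(coord_basis e_basis (memvf x)) linear_sumr (bigD1 i) //=.
rewrite linearZr_LR big1 ?addr0 // => j ji.
by rewrite linearZr_LR /= e_orth ?scaler0 // eq_sym.
Qed.

Lemma mul_expand x y :
  x ** y = \sum_i (coord e i x * coord e i y) *: sq i.
Proof.
rewrite {1}(coord_basis e_basis (memvf x)) linear_sumlz.
by apply: eq_bigr => i _; rewrite linearZl_LR basis_mul scalerA.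
Qed.

Lemma evolution_mulC x y : x ** y = y ** x.
Proof. by rewrite !mul_expand; apply: eq_bigr => i _; rewrite mulrC. Qed.

Lemma diag_sq_neq0 i : diag_coef i != 0 -> sq i != 0.
Proof. by apply: contraNneq => sq0; rewrite /diag_coef sq0 linear0. Qed.

(** Dividing [e_j] by a nonzero [c_jj] makes its square idempotent and fixed by it. Then
    [idempotent_absorbs_nil] applies if [c_kk = 0], and [orthogonal_idempotents] otherwise. *)
Lemma basis_mul_sq i k : diag_coef i != 0 -> k != i -> e`_k ** sq i = 0.
Proof.
move=> di ki; have fE j : diag_coef j != 0 ->
    (diag_coef j)^-1 *: e`_j ** ((diag_coef j)^-1 *: e`_j)
      = (diag_coef j ^- 2) *: sq j.
  by move=> dj; rewrite linearZl_LR linearZr_LR /= scalerA -expr2 exprVn.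
have ff j : diag_coef j != 0 ->
    (diag_coef j)^-1 *: e`_j ** ((diag_coef j ^- 2) *: sq j)
      = (diag_coef j ^- 2) *: sq j.
  move=> dj; rewrite linearZl_LR linearZr_LR /= basis_mul -/(diag_coef j).
  by rewrite !scalerA mulrAC mulVf ?mul1r.
have [dk|dk] := eqVneq (diag_coef k) 0.
  apply: (scalerI (_ : diag_coef i ^- 2 != 0)).
    by rewrite invr_neq0 ?expf_neq0.
  rewrite scaler0 -linearZr_LR.
  apply: (proj1 (@idempotent_absorbs_nil _ _ mul two_neq0 evolution_mulC
    fourth_power ((diag_coef i)^-1 *: e`_i) e`_k _ (sq k)
    (diag_coef i * coord e i (sq k)) (diag_coef i ^- 2 * coord e k (sq i))
    _ (fE i di) erefl (ff i di) _ _ _)).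
  - by rewrite linearZl_LR /= e_orth ?scaler0 // eq_sym.
  - by rewrite basis_mul -/(diag_coef k) dk scale0r.
  - rewrite linearZl_LR /= basis_mul !scalerA; congr (_ *: _).
    by field.
  - by rewrite linearZr_LR /= basis_mul scalerA.
apply: (scalerI (_ : diag_coef k ^- 1 * diag_coef i ^- 2 != 0)).
  by rewrite mulf_neq0 ?invr_neq0 ?expf_neq0.
rewrite scaler0 -scalerA -linearZr_LR -linearZl_LR /=.
(* The rescaled [e_k] plays [f] and the rescaled [e_i] plays [g]; the two scalars are [c_ik] and
   [c_ki] corrected by the rescaling. *)
apply: (@orthogonal_idempotents _ _ mul two_neq0 evolution_mulC
  fourth_power _ ((diag_coef i)^-1 *: e`_i) _ _
  (diag_coef k * diag_coef i ^- 2 * coord e k (sq i))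
  (diag_coef i * diag_coef k ^- 2 * coord e i (sq k))
  _ (fE k dk) (fE i di) (ff k dk) (ff i di) _ _).
- by rewrite linearZl_LR linearZr_LR /= e_orth ?scaler0.
- rewrite linearZl_LR linearZr_LR /= basis_mul !scalerA; congr (_ *: _).
  by field; rewrite di dk.
- rewrite linearZl_LR linearZr_LR /= basis_mul !scalerA; congr (_ *: _).
  by field; rewrite di dk.
Qed.

Lemma sq_mul i x : diag_coef i != 0 ->
  sq i ** x = (diag_coef i * coord e i x) *: sq i.
Proof.
move=> di; rewrite {1}(coord_basis e_basis (memvf x)) linear_sumr (bigD1 i) //=.
rewrite linearZr_LR big1 ?addr0 => [|j ji].
  by rewrite /= evolution_mulC basis_mul scalerA mulrC.
by rewrite linearZr_LR /= evolution_mulC basis_mul_sq ?scaler0.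
Qed.

(** The parameters [al] and [be] let a vanishing diagonal coefficient enter directly as 0. *)
Lemma sq_mul_sq i k al be : coord e i (sq i) = al -> coord e k (sq k) = be ->
  i != k -> (sq i ** sq k) *+ 2 =
  (al * coord e i (sq k)) *: sq i + (be * coord e k (sq i)) *: sq k.
Proof.
move=> <- <- ik.
by have [] := pair_relations two_neq0 evolution_mulC fourth_power
  (e_orth ik) erefl erefl (basis_mul i (sq i)) (basis_mul i (sq k))
  (basis_mul k (sq k)) (basis_mul k (sq i)).
Qed.

(** If [c_kk] is nonzero, [basis_mul_sq] with the indices exchanged gives [c_ki b_i = e_i b_k = 0].
    If it is zero, both [b_i b_k] and its double equal [c_ii c_ki b_i]. *)
Lemma coord_sq i k : diag_coef i != 0 -> k != i -> coord e i (sq k) = 0.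
Proof.
move=> di ki; have sqi := diag_sq_neq0 di.
have [dk|dk] := eqVneq (diag_coef k) 0; last first.
  have ik : i != k by rewrite eq_sym.
  have := basis_mul_sq dk ik => /eqP.
  by rewrite basis_mul scaler_eq0 (negPf sqi) orbF => /eqP.
have ik : i != k by rewrite eq_sym.
have := sq_mul_sq erefl dk ik; rewrite -/(diag_coef i) mul0r scale0r addr0.
rewrite sq_mul // mulr2n => /eqP.
rewrite -subr_eq0 addrK scaler_eq0 (negPf sqi) orbF mulf_eq0 (negPf di).
by move=> /eqP.
Qed.

(** The square of [x] is a combination of the [b_i] with [c_ii = 0], and these annihilate one
    another and themselves. *)
Lemma fourth_power_eq0 x :
  (forall i, diag_coef i != 0 -> coord e i x = 0) -> x ** x ** (x ** x) = 0.
Proof.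
move=> x0; rewrite mul_expand.
have xx : x ** x \in (\sum_(i | diag_coef i == 0%R) <[sq i]>)%VS.
  rewrite mul_expand (bigID (fun i => diag_coef i == 0)) /= [X in _ + X]big1.
    by rewrite addr0; apply: memv_sumr => i _; rewrite memvZ ?memv_line.
  by move=> i /x0 ->; rewrite mul0r scale0r.
rewrite -mul_expand; case/memv_sumP: xx => xs xsk ->.
rewrite linear_sumlz big1 // => i di; rewrite linear_sumr big1 // => k dk.
have [/vlineP[a ->] /vlineP[b ->]] := (xsk i di, xsk k dk).
rewrite linearZl_LR linearZr_LR /= [sq i ** sq k](_ : _ = 0) ?scaler0 //.
have [<-|ik] := eqVneq i k.
  have := sqr_sqr_eigen evolution_mulC fourth_power (basis_mul i (sq i)).
  by rewrite -/(diag_coef i) (eqP di) mulr0 scale0r.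
apply: (double_eq0 two_neq0).
by rewrite (sq_mul_sq (eqP di) (eqP dk) ik) !mul0r !scale0r addr0.
Qed.

End NaturalBasis.

(** * The decomposition of a power-associative evolution algebra *)

Theorem theorem3p5p4 (F : fieldType) (charF : 2%N \notin [pchar F])
    (E : vectType F) (mul : {bilinear E -> E -> E})
    (evoE : evolution_algebra mul fullv)
    (paE : power_associative mul fullv)
    (nnilE : ~ nilalgebra mul fullv) :
  exists (s : nat) (u : 'I_s -> E) (N : {vspace E}),
    [/\ (1 <= s)%N,
        forall i, u i != 0 /\ idempotent_elt mul (u i),
        forall i j, i != j -> mul (u i) (u j) = 0,
        direct_sum_of_algebras mul
          (fun k : option 'I_s => if k is Some i then <[u i]>%VS else N)
          fullv &
        [/\ N = 0%VS \/
              [/\ nilalgebra mul N, power_associative mul N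
                & evolution_algebra mul N],
            semisimple_component mul fullv (\sum_(i < s) <[u i]>)%VS,
            direct_sum_of_algebras mul (fun i : 'I_s => <[u i]>%VS)
              (\sum_(i < s) <[u i]>)%VS
          & nil_radical mul fullv N]].
Proof.
have two_neq0 : 2%:R != 0 :> F by move: charF; rewrite inE /=.
have fourth_power x : mul (mul x x) (mul x x) = mul (mul (mul x x) x) x.
  (* Associativity of the triple [x^2, x, x] in the subalgebra generated by [x]. *)
  apply/esym/(paE x (memvf x)) => V subV xV //; exact: subV.
case: evoE => _ [e e_basis e_orth'].
have e_orth (i j : 'I_(\dim {:E})) : i != j -> mul e`_i e`_j = 0.
  by move=> /e_orth'; rewrite !(tnth_nth 0).
have mulC := evolution_mulC e_basis e_orth.
pose I := [pred i | diag_coef mul e i != 0].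
pose d (k : 'I_#|I|) := diag_coef mul e (enum_val k).
have d_neq0 k : d k != 0 by exact: (enum_valP k).
pose u k := (d k ^- 2) *: mul e`_(enum_val k) e`_(enum_val k).
pose chi (k : 'I_#|I|) : {scalar E} := diag_char mul e (enum_val k).
pose N := <<subfamily e [predC I]>>%VS.
have chiE k x : chi k x = d k * coord e (enum_val k) x by [].
have chi_u k l : chi k (u l) = (k == l)%:R.
  rewrite chiE /u linearZ /=; have [->|kl] := eqVneq k l.
    rewrite -/(diag_coef mul e (enum_val l)) -/(d l); have := d_neq0 l => dl.
    by rewrite mulrCA -expr2 mulVf ?expf_neq0.
  rewrite (coord_sq two_neq0 e_basis e_orth fourth_power (d_neq0 k)) ?mulr0 //.
  by rewrite (inj_eq enum_val_inj) eq_sym.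
have u_mul k x : mul (u k) x = chi k x *: u k.
  rewrite linearZl_LR /= (sq_mul two_neq0 e_basis e_orth fourth_power _ (d_neq0 k)).
  by rewrite !scalerA mulrC.
have chiM k x y : chi k (mul x y) = chi k x * chi k y.
  rewrite !chiE {1}(mul_expand e_basis e_orth) linear_sum /=.
  rewrite (bigD1 (enum_val k)) //= linearZ /= big1 ?addr0 => [|j jk].
    by rewrite -/(diag_coef mul e (enum_val k)) -/(d k); ring.
  rewrite linearZ /=.
  by rewrite (coord_sq two_neq0 e_basis e_orth fourth_power (d_neq0 k)) ?mulr0.
have coord0 x : (forall k, chi k x = 0) <->
    (forall i, diag_coef mul e i != 0 -> coord e i x = 0).
  split=> [x0 i di|x0 k]; last by rewrite chiE (x0 _ (d_neq0 k)) mulr0.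
  have iI : i \in I by [].
  have := x0 (enum_rank_in iI i); rewrite chiE enum_rankK_in // => /eqP.
  by rewrite mulf_eq0 (negPf (d_neq0 _)) => /eqP.
have inN x : x \in N <-> forall k, chi k x = 0.
  rewrite coord0 (mem_span_subfamily _ _ e_basis).
  by split=> x0 i di; apply: x0; move: di; rewrite !inE ?negbK.
have nilN : nilalgebra mul N.
  move=> x /inN/coord0 x0; exists 4%N => //; rewrite /principal_power /=.
  rewrite -fourth_power.
  exact: (fourth_power_eq0 two_neq0 e_basis e_orth fourth_power).
exists #|I|, u, N; split.
(* Without characters, [N] would be the whole algebra, which would then be nil. *)
- rewrite lt0n; apply/eqP => I0; apply: nnilE => x _; apply: nilN.
  by apply/inN => k; have := ltn_ord k; rewrite {2}I0.
- move=> k; have uu : mul (u k) (u k) = u k by rewrite u_mul chi_u eqxx scale1r.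
  split=> //; apply/eqP => uk0; have := chi_u k k.
  by rewrite uk0 linear0 eqxx => /esym/eqP; rewrite oner_eq0.
- by move=> k l kl; rewrite u_mul chi_u (negPf kl) scale0r.
- exact: (direct_sum_lines_N mulC chiM chi_u u_mul inN).
split; last exact: (nil_radical_N chiM inN nilN).
- right; split=> //; first by move=> x _; exact: paE (memvf x).
  apply: evolution_subfamily e_orth _; first exact: basis_free e_basis.
  exact: (subalgebra_N chiM inN).
- exact: (semisimple_component_lines chiM chi_u u_mul inN nilN).
- exact: (direct_sum_lines chi_u u_mul).
Qed.
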